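(* Let $(\Omega,\mathcal{F},\mathbb{P})$ be a probability space and let $\mathcal{G}$ be a sub-$\sigma$-algebra of $\mathcal{F}$. Let $X$ be an $\mathcal{M}$-valued random variable such that $h(X)$ is $\mathbb{P}$-square integrable. Then the best predictor $E_d[X|\mathcal{G}]$ of $X$ given $\mathcal{G}$ in the distance $D_\phi$ is $$E_d[X|\mathcal{G}]=H\big(E[h(X)|\mathcal{G}]\big).$$
   Context: $\phi:\mathcal{J}\to\mathbb{R}$ is a strictly convex, three times continuously differentiable function with $\phi''>0$ on a bounded or unbounded interval $\mathcal{J}\subset\mathbb{R}$, and $\mathcal{M}=\mathcal{J}^K$. The function $h:\mathcal{J}\to\mathbb{R}$ is a primitive of $(\phi'')^{1/2}$ (strictly increasing), and $H=h^{-1}$ is its compositional inverse, defined on $h(\mathcal{J})$; both $h$ and $H$ act componentwise on vectors, $h(x)_i=h(x_i)$. The geodesic distance on $\mathcal{M}$ of the Riemannian metric $g_{i,j}(x)=\phi''(x_i)\delta_{i,j}$ is $d_\phi(x,y)=\big(\sum_{i=1}^K(h(y_i)-h(x_i))^2\big)^{1/2}$. An $\mathcal{M}$-valued random variable $X$ belongs to $\mathcal{L}^\phi_2$ if $E[d_\phi(X,x_0)^2]<\infty$ for some $x_0\in\mathcal{M}$. For $X,Y\in\mathcal{L}^\phi_2$, $$D_\phi(X,Y)^2=E[d_\phi(X,Y)^2]=E[\|h(X)-h(Y)\|^2].$$ The best predictor ($d$-conditional expectation) $E_d[X|\mathcal{G}]$ is the minimizer of $D_\phi(X,Y)^2$ over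 all $\mathcal{G}$-measurable $\mathcal{M}$-valued $Y\in\mathcal{L}^\phi_2$. Random variables are identified when equal $\mathbb{P}$-a.s.; $\mathcal{F}$ is assumed complete (contains all $\mathbb{P}$-null sets). *)

(* Defs.v *)
From HB Require Import structures.
From mathcomp Require Import all_boot all_order all_algebra.
From mathcomp Require Import all_classical all_reals all_analysis.

Set Implicit Arguments.
Unset Strict Implicit.
Unset Printing Implicit Defensive.

Import Order.TTheory GRing.Theory Num.Theory.
Import numFieldNormedType.Exports.

Local Open Scope classical_set_scope.
Local Open Scope ring_scope.

(* Functions on the interval J are total functions R -> R of which only the
   values on J matter.  J may contain its endpoints, where the derivative is
   one-sided; hence the limit is taken along J. *)
Definition is_derive_within (R : realType) (J : set R) (f : R -> R) (x l : R) :=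
  (fun y => (f y - f x) / (y - x)) @ within J x^' --> l.

Definition primitive_on (R : realType) (J : set R) (f g : R -> R) :=
  forall x, J x -> is_derive_within J f x (g x).

Definition strictly_convex_on (R : realType) (J : set R) (f : R -> R) :=
  forall x y t, J x -> J y -> x != y -> 0 < t < 1 ->
    f (t * x + (1 - t) * y) < t * f x + (1 - t) * f y.

(* The manifold M = J^K. *)
Definition cartesian_power (R : realType) (J : set R) (K : nat) : set 'rV[R]_K :=
  [set x | forall i, J (x 0 i)].

Definition dist_phi (R : realType) (h : R -> R) (K : nat) (x y : 'rV[R]_K) : R :=
  Num.sqrt (\sum_(i < K) (h (y 0 i) - h (x 0 i)) ^+ 2).

Definition random_vector d (T : measurableType d) (R : realType) (K : nat)
    (Y : T -> 'rV[R]_K) :=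
  forall i, measurable_fun [set: T] (fun w => Y w 0 i).

Definition is_sub_sigma_algebra d (T : measurableType d) (G : set (set T)) :=
  sigma_algebra [set: T] G /\ G `<=` measurable.

(* Measurability with respect to the sigma-algebra G on the domain (note that
   <<s G >> = G when G is a sigma-algebra). *)
Definition measurable_wrt (T : pointedType) (G : set (set T)) (R : realType)
    (f : T -> R) :=
  measurable_fun [set: g_sigma_algebraType G] (f : g_sigma_algebraType G -> R).

Definition random_vector_wrt (T : pointedType) (G : set (set T)) (R : realType)
    (K : nat) (Y : T -> 'rV[R]_K) :=
  forall i, measurable_wrt G (fun w => Y w 0 i).

(* Z is a version of E[f | G]. *)
Definition is_cond_exp d (T : measurableType d) (R : realType)
    (P : probability T R) (G : set (set T)) (f Z : T -> R) :=
  [/\ measurable_wrt G Z,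
      P.-integrable [set: T] (EFin \o Z) &
      forall A, G A ->
        (\int[P]_(w in A) (Z w)%:E = \int[P]_(w in A) (f w)%:E)%E].

Definition is_cond_exp_vec d (T : measurableType d) (R : realType)
    (P : probability T R) (G : set (set T)) (K : nat) (f Z : T -> 'rV[R]_K) :=
  forall i, is_cond_exp P G (fun w => f w 0 i) (fun w => Z w 0 i).

Definition square_integrable_vec d (T : measurableType d) (R : realType)
    (P : probability T R) (K : nat) (f : T -> 'rV[R]_K) :=
  forall i, (fun w => f w 0 i) \in Lfun P 2%:E.

(* D_phi(X, Y)^2, possibly +oo. *)
Definition Dphi2 d (T : measurableType d) (R : realType) (P : probability T R)
    (h : R -> R) (K : nat) (X Y : T -> 'rV[R]_K) : \bar R :=
  'E_P[fun w => dist_phi h (X w) (Y w) ^+ 2].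

(* The class L_2^phi of M-valued random variables. *)
Definition L2phi d (T : measurableType d) (R : realType) (P : probability T R)
    (J : set R) (h : R -> R) (K : nat) (Y : T -> 'rV[R]_K) :=
  [/\ random_vector Y,
      forall w, cartesian_power J (Y w) &
      exists2 x0 : 'rV[R]_K, cartesian_power J x0 &
        (Dphi2 P h Y (fun=> x0) < +oo)%E].

Definition predictor d (T : measurableType d) (R : realType)
    (P : probability T R) (G : set (set T)) (J : set R) (h : R -> R) (K : nat)
    (Y : T -> 'rV[R]_K) :=
  L2phi P J h Y /\ random_vector_wrt G Y.

(* Y is a version of E_d[X | G]. *)
Definition is_best_predictor d (T : measurableType d) (R : realType)
    (P : probability T R) (G : set (set T)) (J : set R) (h : R -> R) (K : nat)
    (X Y : T -> 'rV[R]_K) :=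
  predictor P G J h Y /\
  forall Y', predictor P G J h Y' -> (Dphi2 P h X Y <= Dphi2 P h X Y')%E.

(* Main.v *)
Require Import Defs.
From HB Require Import structures.
From mathcomp Require Import all_boot all_order all_algebra.
From mathcomp Require Import finmap.
From mathcomp Require Import all_classical all_reals all_analysis.
From mathcomp Require Import measurable_realfun ring lra.

(** The map h, applied componentwise, is an isometry of M onto the product of
    K copies of the interval h(J) with its Euclidean distance, so D_phi(X, Y)^2
    is the sum over i of E[(h(Y_i) - h(X_i))^2].  Predicting X in D_phi is
    therefore predicting h(X) in L^2, with predictions confined to h(J)^K.

    Without that constraint, the answer is the conditional expectation
    Z = E[h(X)|G], by orthogonality: Z_i - h(X_i) has zero integral against
    every element of L^2(G), so that, for every predictor Y,
      D_phi(X, Y)^2 = sum_i E[(h(Y_i) - Z_i)^2] + sum_i E[(Z_i - h(X_i))^2]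
    ([cond_exp_pythagoras], [Dphi2_pythagoras]).  The constraint is harmless:
    since h(J) is an interval, Z_i lies in h(J) almost surely
    ([cond_exp_in_interval]), so H(Z) makes sense and, once redefined on a
    G-measurable null set, is itself a predictor.  It cancels the first sum, and
    any other predictor that cancels it satisfies h(Y) = Z, that is Y = H(Z),
    almost surely.

    What this takes: h is strictly increasing with an interval for image, by the
    mean value and the intermediate value theorems; Z exists, as a Radon-Nikodym
    derivative on G ([cond_exp_exists]); and Z is square integrable whenever
    h(X) is ([cond_exp_Lfun2]). *)

Set Implicit Arguments.
Unset Strict Implicit.
Unset Printing Implicit Defensive.

Import Order.TTheory GRing.Theory Num.Theory.
Import numFieldNormedType.Exports.

Local Open Scope classical_set_scope.
Local Open Scope ring_scope.

(** * Primitives on an interval *)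

(** Near x the difference quotient is bounded by [`|l| + 1], so [f y - f x] is
    at most proportional to [y - x]; this also covers the endpoints of J. *)
Lemma is_derive_within_cvg (R : realType) (J : set R) (f : R -> R) (x l : R) :
  is_derive_within J f x l -> f y @[y --> within J (nbhs x)] --> f x.
Proof.
move=> fl; apply/cvgrPdist_le => e e0.
have : \forall y \near within J x^', `|l - (f y - f x) / (y - x)| <= 1.
  by move/cvgrPdist_le : fl; apply; exact: ltr01.
move=> -[d /= d0 H].
pose c := `|l| + 1.
have c0 : 0 < c by rewrite /c ltr_wpDl.
have : \forall y \near x, `|x - y| < Num.min d (e / c).
  by exists (Num.min d (e / c)) => //=; rewrite lt_min d0 divr_gt0.
apply: filterS => y; rewrite lt_min => /andP[yd ye] Jy.
have [->|yx] := eqVneq y x; first by rewrite subrr normr0 ltW.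
have {}H := H y yd yx Jy.
have yx0 : y - x != 0 by rewrite subr_eq0.
have qc : `|(f y - f x) / (y - x)| <= c.
  rewrite /c -lerBlDl; apply: le_trans H.
  by rewrite distrC; exact: lerB_dist.
rewrite distrC -[f y - f x](divfK yx0) normrM (distrC y x).
apply: (le_trans (ler_pM _ _ qc (ltW ye))) => //.
by rewrite mulrC divfK// gt_eqF.
Qed.

Lemma is_derive_within_interior (R : realType) (J : set R) (f : R -> R)
    (x l : R) : nbhs x J -> is_derive_within J f x l -> is_derive x 1 f l.
Proof.
move=> Jx fl.
have cvgl : h^-1 *: ((f \o shift x) (h *: (1 : R)) - f x) @[h --> 0^'] --> l.
  apply/cvgrPdist_le => e e0.
  move/cvgrPdist_le : fl => /(_ e e0).
  move=> -[d /= d0 H].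
  case: Jx => r /= r0 xJ.
  exists (Num.min d r) => /=; first by rewrite lt_min d0.
  move=> h /=; rewrite sub0r normrN lt_min => /andP[hd hr] h0.
  have xh : x - (h + x) = - h by rewrite [h + x]addrC opprD addNKr.
  have := H (h + x); rewrite /ball_ /= xh normrN addrK => /(_ hd).
  rewrite /GRing.scale/= mulr1 [h^-1 * _]mulrC; apply.
    by rewrite -subr_eq0 addrK.
  by apply: xJ; rewrite /ball_ /= xh normrN.
by apply: DeriveDef; [apply/cvg_ex; exists l | exact: cvg_lim].
Qed.

Lemma is_interval_subitv (R : realType) (J : set R) (a b : R) :
  is_interval J -> J a -> J b -> `[a, b]%classic `<=` J.
Proof. by move=> J_itv Ja Jb x /=; rewrite in_itv/=; exact: J_itv. Qed.

Lemma primitive_on_continuous (R : realType) (J : set R) (f g : R -> R) :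
  primitive_on J f g -> {within J, continuous f}.
Proof.
by move=> fg; apply/subspace_continuousP => x /fg; exact: is_derive_within_cvg.
Qed.

(** The mean value theorem needs two-sided derivatives only inside ]a, b[, whose
    points are interior to J; at a and b continuity along J is enough. *)
Lemma primitive_on_strictly_increasing (R : realType) (J : set R)
    (f g : R -> R) : is_interval J -> primitive_on J f g ->
  (forall x, J x -> 0 < g x) -> forall a b, J a -> J b -> a < b -> f a < f b.
Proof.
move=> J_itv fg g0 a b Ja Jb ab.
have abJ := is_interval_subitv J_itv Ja Jb.
have [||c cab] := @MVT R f g a b ab.
- move=> x xab.
  have Jx : J x by apply/abJ/(subset_itvW _ _ (lexx _) (lexx _) xab).
  apply: is_derive_within_interior (fg _ Jx).
  have := near_in_itvoo xab; apply: filterS => y yab.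
  by apply/abJ/(subset_itvW _ _ (lexx _) (lexx _) yab).
- exact: continuous_subspaceW abJ (primitive_on_continuous fg).
move=> /eqP; rewrite subr_eq => /eqP ->.
rewrite ltrDr mulr_gt0 ?subr_gt0//; apply/g0/abJ.
exact: (subset_itvW _ _ (lexx _) (lexx _) cab).
Qed.

Lemma primitive_on_image_interval (R : realType) (J : set R) (f g : R -> R) :
  is_interval J -> primitive_on J f g -> is_interval (f @` J).
Proof.
move=> /connected_intervalP J_conn fg; apply/connected_intervalP.
exact: connected_continuous_connected J_conn (primitive_on_continuous fg).
Qed.

Lemma strictly_increasing_on_le (R : realType) (D : set R) (f : R -> R) :
  (forall a b, D a -> D b -> a < b -> f a < f b) ->
  forall a b, D a -> D b -> (f a <= f b) = (a <= b).
Proof.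
move=> f_inc a b Da Db; have [ab|ba|->] := ltgtP a b; last by rewrite lexx.
- by rewrite ltW// f_inc.
- by rewrite leNgt f_inc.
Qed.

(** The trace on D of the preimage of a half-line is an interval. *)
Lemma strictly_increasing_on_measurable (R : realType) (D : set R)
    (f : R -> R) : is_interval D ->
  (forall a b, D a -> D b -> a < b -> f a < f b) -> measurable_fun D f.
Proof.
move=> D_itv f_inc; have f_le := strictly_increasing_on_le f_inc.
apply: (measurability (@RGenCInfty.G R)) => [|/= _ [_] [r] -> <-].
  exact: RGenCInfty.measurableE.
apply: is_interval_measurable => s t /= [Ds rs] [Dt rt] u.
move=> /[dup] sut /andP[su ut].
have Du := D_itv _ _ Ds Dt _ sut; split => //.
by move: rs; rewrite !in_itv/= !andbT => /le_trans; apply; rewrite f_le.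
Qed.

(** * Square integrable functions on a probability space *)

Section Lfun2.
Context d (T : measurableType d) (R : realType) (P : probability T R).
Implicit Types f g : T -> R.

Lemma Lfun2P f : measurable_fun [set: T] f ->
  (\int[P]_w ((f w) ^+ 2)%:E < +oo)%E -> f \in Lfun P 2%:E.
Proof.
move=> mf f2; rewrite inE/=; apply/andP; split; rewrite inE//=.
rewrite /finite_norm unlock poweR_lty//.
by under eq_integral do rewrite /= powR_mulrn// real_normK ?num_real//.
Qed.

Lemma Lfun2_measurable f : f \in Lfun P 2%:E -> measurable_fun [set: T] f.
Proof. by move=> /sub_Lfun_mfun; rewrite inE. Qed.

Lemma Lfun2_integrable f : f \in Lfun P 2%:E ->
  P.-integrable [set: T] (EFin \o f).
Proof.
move=> f2; apply/Lfun1_integrable; apply: Lfun_subset f2 => //.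
- by rewrite lee_fin ler1n.
- exact: fin_num_measure.
- by rewrite lee_fin ler1n.
Qed.

Lemma Lfun2B f g : f \in Lfun P 2%:E -> g \in Lfun P 2%:E ->
  f \- g \in Lfun P 2%:E.
Proof.
have p1 : (1 <= 2%:E :> \bar R)%E by rewrite lee_fin ler1n.
move=> f2 g2; have := @Lfun_submod_closed _ _ _ P 2%:E p1.
by move=> [_ /(_ (-1) _ _ g2 f2)]; rewrite scaleN1r addrC.
Qed.

Lemma integral_sqr_ge0 f : (0 <= \int[P]_w ((f w) ^+ 2)%:E)%E.
Proof. by apply: integral_ge0 => w _; rewrite lee_fin sqr_ge0. Qed.

Lemma negligible_integral_eq0 g (A : set T) :
  P.-integrable [set: T] (EFin \o g) ->
  measurable A -> (forall w, A w -> 0 < g w) ->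
  (\int[P]_(w in A) (g w)%:E = 0)%E -> P.-negligible A.
Proof.
move=> intg mA g0 Ig0.
have mg : measurable_fun A (EFin \o g).
  exact: measurable_funTS (measurable_int _ intg).
have : (\int[P]_(w in A) `|(EFin \o g) w| = 0)%E.
  rewrite -[RHS]Ig0; apply: eq_integral => w; rewrite inE => /g0 gw.
  by rewrite /= gtr0_norm.
move=> /(ae_eq_integral_abs _ mA mg); apply: negligibleS => w Aw /=.
by move=> /(_ Aw) /eqP; rewrite eqe gt_eqF// g0.
Qed.

End Lfun2.

(** * Conditional expectation *)

Section sub_sigma_algebra.
Context d (T : measurableType d) (R : realType) (P : probability T R).
Variables (G : set (set T)) (G_sub : is_sub_sigma_algebra G).
Implicit Types f g V W Z : T -> R.

Local Notation TG := (g_sigma_algebraType G).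

Lemma measurable_wrtE (A : set T) :
  measurable (A : set TG) = G A.
Proof. by case: G_sub => /sigma_algebra_id GE _; rewrite -[in RHS]GE. Qed.

Lemma measurable_id_wrt : measurable_fun [set: T] (id : T -> TG).
Proof.
by move=> _ A; rewrite setTI measurable_wrtE => GA; case: G_sub => _; exact.
Qed.

Lemma measurable_wrt_measurable f :
  measurable_wrt G f -> measurable_fun [set: T] f.
Proof. by move=> mf; exact: (measurableT_comp mf measurable_id_wrt). Qed.

Lemma measurable_wrt_preimage f (B : set R) :
  measurable_wrt G f -> measurable B -> G (f @^-1` B).
Proof.
move=> mf mB; rewrite -measurable_wrtE -[X in measurable X]setTI.
exact: mf.
Qed.

(** On the measurable space (T, G), the charge A |-> \int_A f dP is dominated by
    the restriction of P; its Radon-Nikodym derivative is a version of E[f|G].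
    Both set functions are restricted to G by pushing them forward along the
    identity from T to (T, G). *)
Lemma cond_exp_exists f : P.-integrable [set: T] (EFin \o f) ->
  exists Z, is_cond_exp P G f Z.
Proof.
move=> intf.
pose idG : {mfun T >-> TG} := mfun_Sub (mem_set measurable_id_wrt).
pose PG := distribution P idG.
have mid := measurable_id_wrt.
(* The charge structure of a pushforward takes a measurability proof in each of
   its three parts, which packing leaves as arguments. *)
pose nu_ : {charge set TG -> \bar R} :=
  HB.pack (pushforward (induced_charge intf) (id : T -> TG))
    (Charge.on (pushforward (induced_charge intf) (id : T -> TG))).
pose nu := nu_ mid mid mid.
have nuPG : nu `<< PG.
  apply/null_content_dominatesP => A mA PA0.
  apply: null_set_integral.
  - by apply: G_sub.2; rewrite -measurable_wrtE.
  - exact: measurable_funTS (measurable_int _ intf).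
  - exact: PA0.
pose D := Radon_Nikodym nu PG.
have D_fin w : D w \is a fin_num by exact: Radon_Nikodym_fin_num.
have D_int : PG.-integrable setT D by exact: Radon_Nikodym_integrable.
have DE : EFin \o (fine \o D) = D by apply/funext => w /=; rewrite fineK.
have mD : measurable_fun setT D by exact: measurable_int D_int.
exists (fine \o D).
have intZ : P.-integrable [set: T] (EFin \o (fine \o D : T -> R)).
  rewrite DE; apply/integrableP; split.
    exact: (measurableT_comp mD measurable_id_wrt).
  move/integrableP : D_int => [_].
  by rewrite ge0_integral_distribution//; exact: measurableT_comp.
split => //.
  by apply/measurable_EFinP; rewrite DE.
move=> A GA; have mA : measurable (A : set TG) by rewrite measurable_wrtE.
transitivity (\int[P]_(w in A) D w)%E.
  by apply: eq_integral => w _; rewrite /= fineK.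
(* [nu A] unfolds to the integral of f on A. *)
transitivity (nu A); last by [].
rewrite (Radon_Nikodym_integral nuPG mA) integral_pushforward//.
apply: (integrableS measurableT) => //.
- exact: (G_sub.2 _ GA).
- by rewrite DE in intZ; exact: intZ.
Qed.

Section null_integrals.
Variable g : T -> R.
Hypotheses (intg : P.-integrable [set: T] (EFin \o g))
  (g_null : forall A, G A -> (\int[P]_(w in A) (g w)%:E = 0)%E).

Let mg : measurable_fun [set: T] g.
Proof. exact/measurable_EFinP/(measurable_int _ intg). Qed.

Import HBNNSimple.

(** A simple function is a finite linear combination of indicators of sets of
    G. *)
Let integral_nnsfun_mul_eq0 (s : {nnsfun TG >-> R}) :
  (\int[P]_w (s w * g w)%:E = 0)%E.
Proof.
pose A y := (s : T -> R) @^-1` [set y].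
have GA y : G (A y).
  by apply: measurable_wrt_preimage => //; exact: measurable_funPT.
have mA y : measurable (A y) by exact: G_sub.2.
have sgE w : ((s w * g w)%:E =
    \sum_(y <- fset_set (range s)) (y%:E * ((EFin \o g) \_ (A y)) w))%E.
  rewrite (fimfunE s) fsbig_finite//= mulr_suml -sumEFin.
  apply: eq_bigr => y _; rewrite -mulrA EFinM patchE indicE; congr (_ * _)%E.
  rewrite (_ : (w \in A y) = (w \in s @^-1` [set y]))//.
  by case: ifP; rewrite ?mul1r ?mul0r.
have intA y : P.-integrable [set: T] ((EFin \o g) \_ (A y)).
  apply/(integrable_mkcond _ (mA y)).
  exact: (integrableS measurableT).
under eq_integral do rewrite sgE.
rewrite integral_sum//; last by move=> y; exact: integrableZl.
apply: big1 => y _.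
by rewrite integralZl// -integral_mkcond g_null// mule0.
Qed.

(** Simple functions increase to W, and the products with g are dominated by
    [`|W * g|]. *)
Let ge0_integral_mul_eq0 W : (forall w, 0 <= W w) ->
  measurable_wrt G W -> P.-integrable [set: T] (EFin \o (W \* g)) ->
  (\int[P]_w (W w * g w)%:E = 0)%E.
Proof.
move=> W0 mW intWg.
have mW' : measurable_fun [set: TG] (EFin \o W) by exact/measurable_EFinP.
pose s := nnsfun_approx measurableT mW'.
have s_le n w : s n w <= W w.
  rewrite -lee_fin /s nnsfun_approxE.
  by apply: le_approx => // ? _; rewrite lee_fin.
have s_cvg w : s n w @[n --> \oo] --> W w.
  have /fine_cvgP[_] : (s n w)%:E @[n --> \oo] --> (W w)%:E; last by [].
  by apply: cvg_nnsfun_approx => // ? _; rewrite lee_fin.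
have [|||||_ _] := @dominated_convergence _ _ _ P setT measurableT
    (fun n w => (s n w * g w)%:E) (fun w => (W w * g w)%:E)
    (fun w => `|(W w * g w)%:E|%E).
- move=> n; apply/measurable_EFinP/measurable_funM => //.
  apply: measurable_wrt_measurable; exact: measurable_funPT.
- exact: measurable_int intWg.
- apply: aeW => w _; apply: cvg_EFin; first by near=> n.
  by apply: cvgMl; exact: s_cvg.
- exact: integrable_abse intWg.
- apply: aeW => w n _; rewrite lee_fin !normrM ler_wpM2r// ger0_norm//.
  by rewrite ger0_norm.
move=> /cvg_lim <-//; rewrite (_ : [sequence _]_n = cst 0%E) ?lim_cst//.
by apply/funext => n /=; exact: integral_nnsfun_mul_eq0.
Unshelve. all: by end_near. Qed.

(** A function with zero integral on every set of G is orthogonal to every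
    G-measurable function for which the product is integrable: the positive and
    the negative parts of W are treated separately. *)
Lemma integral_mul_eq0 W : measurable_wrt G W ->
  P.-integrable [set: T] (EFin \o (W \* g)) ->
  (\int[P]_w (W w * g w)%:E = 0)%E.
Proof.
move=> mW intWg.
have part V : measurable_wrt G V -> (forall w, 0 <= V w) ->
    (forall w, V w <= `|W w|) -> P.-integrable [set: T] (EFin \o (V \* g)) /\
    (\int[P]_w (V w * g w)%:E = 0)%E.
  move=> mV V0 VW.
  suff intVg : P.-integrable [set: T] (EFin \o (V \* g)).
    by split => //; exact: ge0_integral_mul_eq0.
  apply: (le_integrable measurableT) intWg.
    apply/measurable_EFinP/measurable_funM => //.
    exact: measurable_wrt_measurable.
  by move=> w _ /=; rewrite lee_fin !normrM ler_wpM2r// ger0_norm.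
have [|||ip Ip] := part (fun w => Num.max (W w) 0).
- exact: measurable_maxr.
- by move=> w; rewrite le_max lexx orbT.
- by move=> w; rewrite ge_max ler_norm normr_ge0.
have [|||im Im] := part (fun w => Num.max (- W w) 0).
- by apply: measurable_maxr => //; exact: measurableT_comp.
- by move=> w; rewrite le_max lexx orbT.
- by move=> w; rewrite ge_max -normrN ler_norm normr_ge0.
rewrite (eq_integral (fun w =>
    (Num.max (W w) 0 * g w)%:E - (Num.max (- W w) 0 * g w)%:E)%E).
  by rewrite integralB// Ip Im sube0.
move=> w _; rewrite -EFinB -mulrBl; congr (_ * _)%:E.
by case: (leP (W w) 0); case: (leP (- W w) 0); lra.
Qed.

End null_integrals.

Lemma cond_exp_null f Z : P.-integrable [set: T] (EFin \o f) ->
  is_cond_exp P G f Z ->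
  P.-integrable [set: T] (EFin \o (Z \- f)) /\
  forall A, G A -> (\int[P]_(w in A) (Z w - f w)%:E = 0)%E.
Proof.
move=> intf [mZ intZ ZE]; split.
  by have := integrableB measurableT intZ intf.
move=> A GA; have mA := G_sub.2 _ GA.
have intfA := integrableS measurableT mA (@subsetT _ _) intf.
have intZA := integrableS measurableT mA (@subsetT _ _) intZ.
under eq_integral do rewrite EFinB.
rewrite integralB// ZE// subee//.
exact: integrable_fin_num.
Qed.

(** Truncate Z to W := Z 1_A with A := {|Z| <= n}.  As W is bounded and
    G-measurable, it is orthogonal to Z - f, while W ^ 2 <= f ^ 2 + 2 W (Z - f)
    pointwise: on A the difference of the two sides is (Z - f) ^ 2.  Hence the
    integral of Z ^ 2 on A is at most that of f ^ 2, and n goes to infinity. *)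
Lemma cond_exp_Lfun2 f Z : f \in Lfun P 2%:E -> is_cond_exp P G f Z ->
  Z \in Lfun P 2%:E.
Proof.
move=> f2 ZE; have intf := Lfun2_integrable f2.
have [intg g_null] := cond_exp_null intf ZE; have [mZ _ _] := ZE.
have mZT := measurable_wrt_measurable mZ.
pose A n := Z @^-1` `[- n%:R, n%:R].
have GA n : G (A n) by apply: measurable_wrt_preimage.
have mAG n : measurable (A n : set TG) by rewrite measurable_wrtE.
have mA n : measurable (A n) by exact: G_sub.2.
apply: Lfun2P => //.
have ZAE : (\int[P]_(w in A n) ((Z w) ^+ 2)%:E @[n --> \oo] -->
    \int[P]_w ((Z w) ^+ 2)%:E)%E.
  rewrite -[X in (\int[P]_(w in X) _)%E](_ : \bigcup_n A n = setT).
    apply: ge0_nondecreasing_set_cvg_integral => //.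
    - move=> m n mn; apply/subsetPset => w; rewrite /A/= !in_itv/= -!ler_norml.
      by move=> /le_trans; apply; rewrite ler_nat.
    - move=> n; apply/measurable_EFinP/measurable_funTS; exact: measurable_funX.
    - by move=> n w _; rewrite lee_fin sqr_ge0.
  apply/seteqP; split => // w _.
  exists (Num.bound `|Z w|) => //; rewrite /A/= in_itv/= -ler_norml ltW//.
  exact: archi_boundP.
apply: (@le_lt_trans _ _ (\int[P]_w ((f w) ^+ 2)%:E)%E); last first.
  exact: integrable_lty (Lfun2_integrable_sqr f2).
apply: (cvge_to_le ZAE).
apply: nearW => n.
pose W := Z \_ (A n).
have mW : measurable_wrt G W.
  by apply/(measurable_restrictT _ (mAG n)); exact: measurable_funTS.
have W_bnd w : `|W w| <= n%:R.
  rewrite /W patchE; case: ifPn => [|_]; last by rewrite normr0.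
  by rewrite inE /A/= in_itv/= -ler_norml.
have intWg : P.-integrable [set: T] (EFin \o (W \* (Z \- f))).
  have := @integrableMr _ _ _ P _ measurableT W _ _ _ intg; apply.
    exact: measurable_wrt_measurable.
  by exists n%:R; split => //= M nM w _ /=; exact: le_trans (W_bnd w) (ltW nM).
have Wg0 := integral_mul_eq0 intg g_null mW intWg.
(* Add twice the vanishing integral of W (Z - f) to the right-hand side. *)
rewrite -[leRHS]adde0 -[X in (_ + X)%E](mule0 2%:E) -Wg0 -integralZl//.
rewrite -integralD//; last 2 first.
- exact: Lfun2_integrable_sqr.
- exact: integrableZl.
rewrite [leLHS]integral_mkcond.
apply: ge0_le_integral => //.
- by move=> w _; rewrite patchE; case: ifP => // _; rewrite lee_fin sqr_ge0.
- apply/(measurable_restrictT _ (mA n))/measurable_funTS/measurable_EFinP.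
  exact: measurable_funX.
- apply: emeasurable_funD.
    exact: measurable_int (Lfun2_integrable_sqr f2).
  by apply: measurable_funeM; exact: measurable_int intWg.
move=> w _; rewrite /W !patchE; case: ifP => _; rewrite -EFinM -EFinD lee_fin.
  by rewrite -subr_ge0 (_ : _ - _ = (Z w - f w) ^+ 2) ?sqr_ge0// /=; ring.
by rewrite mul0r mulr0 addr0 sqr_ge0.
Qed.

(** If Z w is not in I, then it is either above all the points of I or below
    all of them.  Each of these two events is in G, and on each of them Z - f
    has a constant strict sign, whereas its integral vanishes.  Phrasing the
    events with the points of I, not with its endpoints, avoids distinguishing
    open, closed and unbounded intervals. *)
Lemma cond_exp_in_interval f Z (I : set R) : is_interval I ->
  P.-integrable [set: T] (EFin \o f) -> (forall w, I (f w)) ->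
  is_cond_exp P G f Z -> {ae P, forall w, I (Z w)}.
Proof.
move=> I_itv intf If ZE.
have [intg g_null] := cond_exp_null intf ZE; have [mZ _ _] := ZE.
pose above := Z @^-1` [set x | forall y, I y -> y < x].
pose below := Z @^-1` [set x | forall y, I y -> x < y].
have Gabove : G above.
  apply: measurable_wrt_preimage => //; apply: is_interval_measurable.
  by move=> a b /= aI bI c /andP[ac _] y /aI /lt_le_trans; exact.
have Gbelow : G below.
  apply: measurable_wrt_preimage => //; apply: is_interval_measurable.
  by move=> a b /= aI bI c /andP[_ cb] y /bI; exact: le_lt_trans.
have above0 : P.-negligible above.
  apply: (negligible_integral_eq0 intg); [exact: G_sub.2| |exact: g_null].
  by move=> w /(_ _ (If w)) /=; rewrite subr_gt0.
have below0 : P.-negligible below.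
  have intNg : P.-integrable [set: T] (EFin \o (f \- Z)).
    have := integrableN intg; congr (integrable _ _ _).
    by apply/funext => w; rewrite /= opprB.
  apply: (negligible_integral_eq0 intNg); [exact: G_sub.2| |].
    by move=> w /(_ _ (If w)) /=; rewrite subr_gt0.
  have mB := G_sub.2 _ Gbelow.
  have intgB := integrableS measurableT mB (@subsetT _ _) intg.
  rewrite (eq_integral (fun w => - (Z w - f w)%:E)%E); last first.
    by move=> w _; rewrite /= opprB.
  by rewrite integralN ?g_null ?oppe0//; exact: integrable_add_def.
apply: negligibleS (negligibleU above0 below0) => w /= NI.
apply: contrapT => /not_orP[/existsNP[y /not_implyP[Iy yZ]]].
move=> /existsNP[x /not_implyP[Ix xZ]]; apply: NI.
by apply: (I_itv x y) => //; rewrite !leNgt; apply/andP; split; apply/negP.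
Qed.

(** The cross term vanishes because V - Z is G-measurable and square
    integrable. *)
Lemma cond_exp_pythagoras f Z V : f \in Lfun P 2%:E -> is_cond_exp P G f Z ->
  measurable_wrt G V -> V \in Lfun P 2%:E ->
  (\int[P]_w ((V w - f w) ^+ 2)%:E =
   \int[P]_w ((V w - Z w) ^+ 2)%:E + \int[P]_w ((Z w - f w) ^+ 2)%:E)%E.
Proof.
move=> f2 ZE mV V2; have Z2 := cond_exp_Lfun2 f2 ZE.
have [intg g_null] := cond_exp_null (Lfun2_integrable f2) ZE.
have VZ2 := Lfun2B V2 Z2; have Zf2 := Lfun2B Z2 f2.
have mVZ : measurable_wrt G (V \- Z) by apply: measurable_funB => //; case: ZE.
have intW : P.-integrable [set: T] (EFin \o ((V \- Z) \* (Z \- f))).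
  by apply/Lfun1_integrable/Lfun2_mul_Lfun1.
have W0 := integral_mul_eq0 intg g_null mVZ intW.
have iVZ := Lfun2_integrable_sqr VZ2; have iZf := Lfun2_integrable_sqr Zf2.
rewrite -[RHS]adde0 -[X in (_ + X)%E](mule0 2%:E) -W0 -integralZl//.
rewrite -integralD// -integralD//; [|exact: integrableD|exact: integrableZl].
apply: eq_integral => w _; rewrite -!EFinM -!EFinD; congr EFin => /=.
ring.
Qed.

End sub_sigma_algebra.

(** * The best predictor *)

Section best_predictor.
Context (R : realType) (J : set R) (h H : R -> R).
Hypotheses (J_itv : is_interval J) (x0 : R) (Jx0 : J x0)
  (h_inc : forall a b, J a -> J b -> a < b -> h a < h b)
  (hJ_itv : is_interval (h @` J))
  (H_inv : forall x, J x -> H (h x) = x).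
Context d (T : measurableType d) (P : probability T R) (K : nat).
Implicit Types X Y Z : T -> 'rV[R]_K.

Let m_h : measurable_fun J h.
Proof. exact: strictly_increasing_on_measurable. Qed.

(** The conditional expectation may leave h(J) on a null set, whereas predictors
    take all their values in J. *)
Definition H_extension (y : R) : R := if y \in h @` J then H y else x0.

Lemma H_extension_in y : J (H_extension y).
Proof.
rewrite /H_extension; by case: ifPn => // /set_mem[x Jx <-]; rewrite H_inv.
Qed.

Lemma measurable_H_extension : measurable_fun [set: R] H_extension.
Proof.
have mhJ : measurable (h @` J) by exact: is_interval_measurable.
have mH : measurable_fun (h @` J) H.
  apply: strictly_increasing_on_measurable => // _ _ [x Jx <-] [y Jy <-].
  rewrite !H_inv// => hxy; rewrite ltNge; apply: contraL hxy => yx.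
  by rewrite -leNgt (strictly_increasing_on_le h_inc).
rewrite /H_extension; apply: measurable_fun_if => //.
  apply: (measurable_fun_bool true) => //.
  rewrite setTI (_ : _ @^-1` _ = h @` J)//.
  by apply/seteqP; split => y /= => [/set_mem|/mem_set].
by apply: measurable_funS mhJ _ mH => y /= [_ /set_mem].
Qed.

(** The measurable structure of the domain is left free so that this applies
    both to T and to T with the sub-sigma-algebra G. *)
Lemma random_vector_h d' (T' : measurableType d') (Y : T' -> 'rV[R]_K) :
  random_vector Y -> (forall w, cartesian_power J (Y w)) ->
  forall i, measurable_fun [set: T'] (fun w => h (Y w 0 i)).
Proof.
move=> mY JY i; apply: (measurable_comp _ _ m_h (mY i)) => [|_ [w _ <-]].
  exact: is_interval_measurable.
exact: JY.
Qed.

Lemma Dphi2E X Y :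
  (forall i, measurable_fun [set: T] (fun w => h (X w 0 i))) ->
  (forall i, measurable_fun [set: T] (fun w => h (Y w 0 i))) ->
  (Dphi2 P h X Y =
    \sum_(i < K) \int[P]_w ((h (Y w 0 i) - h (X w 0 i)) ^+ 2)%:E)%E.
Proof.
move=> mX mY; rewrite /Dphi2 unlock.
under eq_integral.
  move=> w _; rewrite sqr_sqrtr; last by apply: sumr_ge0 => i _; exact: sqr_ge0.
  rewrite -sumEFin; over.
rewrite ge0_integral_sum//.
- by move=> i; apply/measurable_EFinP/measurable_funX/measurable_funB.
- by move=> i w _; rewrite lee_fin sqr_ge0.
Qed.

(** The base point of the class is immaterial: square integrability is preserved
    by subtracting a constant. *)
Lemma L2phiP Y : random_vector Y -> (forall w, cartesian_power J (Y w)) ->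
  L2phi P J h Y <-> square_integrable_vec P (fun w => map_mx h (Y w)).
Proof.
move=> mY JY.
have mhY := random_vector_h mY JY.
have hYE i : (fun w => map_mx h (Y w) 0 i) = (fun w => h (Y w 0 i)).
  by apply/funext => w; rewrite mxE.
have cL2 (c : R) : cst c \in Lfun P 2%:E by exact: Lfun_cst.
have DE x := @Dphi2E Y (fun=> x) mhY (fun i => measurable_cst (h (x 0 i))).
split=> [[_ _ [x _]]|hY2].
  rewrite DE => fin i; rewrite hYE.
  have mcV : measurable_fun [set: T] (fun w => h (x 0 i) - h (Y w 0 i)).
    exact: measurable_funB.
  have : (fun w => h (x 0 i) - h (Y w 0 i)) \in Lfun P 2%:E.
    apply: Lfun2P => //; apply: le_lt_trans fin.
    rewrite (bigD1 i)//= leeDl// sume_ge0// => j _.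
    exact: integral_sqr_ge0.
  move=> /(Lfun2B (cL2 (h (x 0 i)))).
  rewrite (_ : _ \- _ = fun w => h (Y w 0 i))//.
  by apply/funext => w /=; rewrite subKr.
split => //; exists (const_mx x0); first by move=> i; rewrite mxE.
rewrite DE; apply: lte_sum_pinfty => i _.
apply: (integrable_lty measurableT) (Lfun2_integrable_sqr (Lfun2B (cL2 _) _)).
by rewrite -hYE.
Qed.

Variables (G : set (set T)) (G_sub : is_sub_sigma_algebra G).
Variables (X Z : T -> 'rV[R]_K).
Hypotheses (X_meas : random_vector X)
  (X_val : forall w, cartesian_power J (X w))
  (hX_L2 : square_integrable_vec P (fun w => map_mx h (X w)))
  (ZE : is_cond_exp_vec P G (fun w => map_mx h (X w)) Z).

Let hX2 i : (fun w => h (X w 0 i)) \in Lfun P 2%:E.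
Proof. by have := hX_L2 i; under eq_fun do rewrite mxE. Qed.

Let hZ i : is_cond_exp P G (fun w => h (X w 0 i)) (fun w => Z w 0 i).
Proof. by have := ZE i; under eq_fun do rewrite mxE. Qed.

Lemma cond_exp_vec_range : {ae P, forall w, cartesian_power (h @` J) (Z w)}.
Proof.
apply: filter_forall => i.
apply: (cond_exp_in_interval G_sub hJ_itv _ _ (hZ i)).
  exact: Lfun2_integrable.
by move=> w; exists (X w 0 i) => //; exact: X_val.
Qed.

Local Notation residual :=
  (\sum_(i < K) \int[P]_w ((Z w 0 i - h (X w 0 i)) ^+ 2)%:E)%E.

Lemma Dphi2_pythagoras Y : predictor P G J h Y ->
  (Dphi2 P h X Y =
   \sum_(i < K) \int[P]_w ((h (Y w 0 i) - Z w 0 i) ^+ 2)%:E + residual)%E.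
Proof.
move=> [[mY JY Y2] GY].
have mhX := random_vector_h X_meas X_val.
have mhY := random_vector_h mY JY.
rewrite (Dphi2E mhX mhY) -big_split/=; apply: eq_bigr => i _.
apply: (cond_exp_pythagoras G_sub (hX2 i) (hZ i)).
  exact: (@random_vector_h _ (g_sigma_algebraType G) Y GY JY).
have := (L2phiP mY JY).1 (And3 mY JY Y2) i.
by under eq_fun do rewrite mxE.
Qed.

Let Z2 i : (fun w => Z w 0 i) \in Lfun P 2%:E.
Proof. exact: cond_exp_Lfun2 (hX2 i) (hZ i). Qed.

Let residual_fin_num : residual \is a fin_num.
Proof.
rewrite ge0_fin_numE; last first.
  by apply: sume_ge0 => i _; exact: integral_sqr_ge0.
apply: lte_sum_pinfty => i _.
apply: (integrable_lty measurableT).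
exact: Lfun2_integrable_sqr (Lfun2B (Z2 i) (hX2 i)).
Qed.

(** Such a Y has h(Y) = Z almost surely, so the distance from h(Y) to Z
    vanishes. *)
Let attains Y : random_vector_wrt G Y -> (forall w, cartesian_power J (Y w)) ->
  {ae P, forall w, Y w = map_mx H (Z w)} ->
  predictor P G J h Y /\ Dphi2 P h X Y = residual.
Proof.
move=> GY JY YE.
have mY : random_vector Y by move=> i; exact: measurable_wrt_measurable (GY i).
have mhY := random_vector_h mY JY.
have hYE : {ae P, forall w, forall i, h (Y w 0 i) = Z w 0 i}.
  move: YE cond_exp_vec_range; apply: filterS2 => w -> hJZ i; rewrite mxE.
  by have [x Jx <-] := hJZ i; rewrite H_inv.
have Ypred : predictor P G J h Y.
  split=> //; apply/L2phiP => // i; under eq_fun do rewrite mxE.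
  apply: Lfun2P => //.
  rewrite (ae_eq_integral (fun w => ((Z w 0 i) ^+ 2)%:E))//.
  - exact: integrable_lty (Lfun2_integrable_sqr (Z2 i)).
  - exact/measurable_EFinP/measurable_funX.
  - exact/measurable_EFinP/measurable_funX/Lfun2_measurable.
  - by apply: filterS hYE => w wE _; rewrite wE.
split => //; rewrite Dphi2_pythagoras// big1 ?add0e// => i _.
rewrite (ae_eq_integral (cst 0%E)) ?integral0//.
- apply/measurable_EFinP/measurable_funX/measurable_funB => //.
  exact: Lfun2_measurable.
- by apply: filterS hYE => w wE _; rewrite wE subrr expr0n.
Qed.

Lemma best_predictor_candidate : exists Y,
  [/\ random_vector_wrt G Y, forall w, cartesian_power J (Y w) &
      {ae P, forall w, Y w = map_mx H (Z w)}].
Proof.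
exists (fun w => map_mx H_extension (Z w)); split.
- move=> i; rewrite /measurable_wrt; under eq_fun do rewrite mxE.
  by apply: (measurableT_comp measurable_H_extension); case: (ZE i).
- by move=> w i; rewrite mxE; exact: H_extension_in.
- apply: filterS cond_exp_vec_range => w hJZ; apply/rowP => i; rewrite !mxE.
  by rewrite /H_extension mem_set.
Qed.

(** Comparing a best predictor with a candidate that attains the residual forces
    the sum of the E[(h(Y_i) - Z_i)^2] to vanish; the residual can be cancelled
    because it is finite. *)
Lemma is_best_predictor_iff Y : is_best_predictor P G J h X Y <->
  [/\ random_vector_wrt G Y, forall w, cartesian_power J (Y w) &
      {ae P, forall w, Y w = map_mx H (Z w)}].
Proof.
split=> [[Ypred Ymin]|[GY JY YE]]; last first.
  have [Ypred DY] := attains GY JY YE; split => // Y' Y'pred.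
  rewrite DY Dphi2_pythagoras// leeDr//; apply: sume_ge0 => i _.
  exact: integral_sqr_ge0.
have [Ys [GYs JYs YsE]] := best_predictor_candidate.
have [Yspred DYs] := attains GYs JYs YsE.
have [[mY JY _] GY] := Ypred; split => //.
have mhY := random_vector_h mY JY.
have := Ymin _ Yspred.
rewrite DYs Dphi2_pythagoras// -[leRHS]add0e leeD2rE// => le0.
have hYE : {ae P, forall w, forall i, h (Y w 0 i) = Z w 0 i}.
  apply: filter_forall => i.
  have I0 : (\int[P]_w ((h (Y w 0 i) - Z w 0 i) ^+ 2)%:E = 0)%E.
    apply/eqP; rewrite eq_le integral_sqr_ge0 andbT; apply: le_trans le0.
    by rewrite (bigD1 i)//= leeDl// sume_ge0// => j _; exact: integral_sqr_ge0.
  have mD : measurable_fun [set: T]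
      (fun w => ((h (Y w 0 i) - Z w 0 i) ^+ 2)%:E).
    apply/measurable_EFinP/measurable_funX/measurable_funB => //.
    exact: Lfun2_measurable.
  have /(ae_eq_integral_abs P measurableT mD) :
      (\int[P]_w `|((h (Y w 0 i) - Z w 0 i) ^+ 2)%:E| = 0)%E.
    rewrite -[RHS]I0; apply: eq_integral => w _.
    by rewrite gee0_abs// lee_fin sqr_ge0.
  apply: filterS => w /(_ I) /eqP; rewrite eqe sqrf_eq0 subr_eq0.
  by move/eqP.
apply: filterS hYE => w hYZ; apply/rowP => i; rewrite mxE -hYZ H_inv//.
exact: JY.
Qed.

End best_predictor.

Theorem theorem3p2 (R : realType)
  (* the interval J and the function phi, with its first three derivatives *)
  (J : set R) (J_itv : is_interval J) (J_nondeg : J° !=set0)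
  (phi phi1 phi2 phi3 : R -> R)
  (phi_convex : strictly_convex_on J phi)
  (phi_d1 : primitive_on J phi phi1)
  (phi_d2 : primitive_on J phi1 phi2)
  (phi_d3 : primitive_on J phi2 phi3)
  (phi3_cont : {within J, continuous phi3})
  (phi2_gt0 : forall x, J x -> 0 < phi2 x)
  (* h is a primitive of sqrt(phi'') on J, and H its inverse on h(J) *)
  (h H : R -> R)
  (h_prim : primitive_on J h (fun x => Num.sqrt (phi2 x)))
  (H_inv : forall x, J x -> H (h x) = x)
  (* a complete probability space and a sub-sigma-algebra *)
  (d : measure_display) (T : measurableType d) (P : probability T R)
  (P_complete : measure_is_complete P)
  (G : set (set T)) (G_sub : is_sub_sigma_algebra G)
  (K : nat) (X : T -> 'rV[R]_K)
  (X_meas : random_vector X) (X_val : forall w, cartesian_power J (X w))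
  (hX_L2 : square_integrable_vec P (fun w => map_mx h (X w))) :
  (exists Z : T -> 'rV[R]_K,
      is_cond_exp_vec P G (fun w => map_mx h (X w)) Z) /\
  (exists Y : T -> 'rV[R]_K, is_best_predictor P G J h X Y) /\
  forall Z : T -> 'rV[R]_K,
    is_cond_exp_vec P G (fun w => map_mx h (X w)) Z ->
    (* H is applied to values in its domain h(J) *)
    {ae P, forall w, cartesian_power (h @` J) (Z w)} /\
    forall Y : T -> 'rV[R]_K,
      is_best_predictor P G J h X Y <->
      [/\ random_vector_wrt G Y,
          forall w, cartesian_power J (Y w) &
          {ae P, forall w, Y w = map_mx H (Z w)}].
Proof.
have [x0 /nbhs_singleton Jx0] := J_nondeg.
have dh_gt0 x : J x -> 0 < Num.sqrt (phi2 x).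
  by move=> Jx; rewrite sqrtr_gt0 phi2_gt0.
have h_inc := primitive_on_strictly_increasing J_itv h_prim dh_gt0.
have hJ_itv := primitive_on_image_interval J_itv h_prim.
have Z_ex : exists Z : T -> 'rV[R]_K,
    is_cond_exp_vec P G (fun w => map_mx h (X w)) Z.
  have /choice[Z ZE] i := cond_exp_exists G_sub (Lfun2_integrable (hX_L2 i)).
  exists (fun w => \row_j Z j w) => i.
  rewrite (_ : (fun w => (\row_j Z j w) 0 i) = Z i) => [|]; first exact: ZE.
  by apply/funext => w; rewrite mxE.
split => //; split.
  have [Z ZE] := Z_ex.
  have [Y YE] := best_predictor_candidate Jx0 h_inc hJ_itv H_inv G_sub
    X_val hX_L2 ZE.
  by exists Y; apply/(is_best_predictor_iff J_itv Jx0 h_inc hJ_itv H_inv G_sub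
    X_meas X_val hX_L2 ZE).
move=> Z ZE; split=> [|Y].
  exact: (cond_exp_vec_range hJ_itv G_sub X_val hX_L2 ZE).
exact: (is_best_predictor_iff J_itv Jx0 h_inc hJ_itv H_inv G_sub
  X_meas X_val hX_L2 ZE).
Qed.
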